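(* Let $A,B\subseteq\omega$ with $B$ infinite, and suppose $A$ is c.e. relative to every infinite subset of $B$. Then there is a nonempty $\Sigma^1_1(B)$ class $\mathcal{E}$ of infinite subsets of $B$ such that for every $C\in\mathcal{E}$ there is a single relative c.e. operator $\Theta$ with $\Theta(S) = A$ for every infinite $S\subseteq C$.
   Context: A relative c.e. operator is a c.e. set $\Theta$ of pairs $(\sigma,x)\in 2^{<\omega}\times\omega$, with $\Theta(X)$ the set of $x$ such that $(\sigma,x)\in\Theta$ for some initial segment $\sigma$ of the characteristic function of $X$. *)

(* Defs.v *)
From Stdlib Require Import List Arith.
Import ListNotations.

Definition subset_of_omega := nat -> bool.

(** Syntax of partial recursive functions with one oracle primitive.
    Arguments are passed as a list of naturals (missing arguments read 0). *)
Inductive rfun : Type :=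
| RZero
| RSucc
| RProj (i : nat)
| ROracle
| RComp (f : rfun) (gs : list rfun)
| RPrimRec (f g : rfun)
| RMin (f : rfun).

Inductive eval (o : nat -> nat) : rfun -> list nat -> nat -> Prop :=
| ev_zero xs : eval o RZero xs 0
| ev_succ xs : eval o RSucc xs (S (nth 0 xs 0))
| ev_proj i xs : eval o (RProj i) xs (nth i xs 0)
| ev_oracle xs : eval o ROracle xs (o (nth 0 xs 0))
| ev_comp f gs xs ys v :
    evals o gs xs ys -> eval o f ys v -> eval o (RComp f gs) xs v
| ev_rec0 f g xs v :
    eval o f xs v -> eval o (RPrimRec f g) (0 :: xs) v
| ev_recS f g n xs w v :
    eval o (RPrimRec f g) (n :: xs) w ->
    eval o g (n :: w :: xs) v ->
    eval o (RPrimRec f g) (S n :: xs) v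
| ev_rec_nil f g v :
    eval o (RPrimRec f g) [0] v -> eval o (RPrimRec f g) [] v
| ev_min f xs y :
    eval o f (y :: xs) 0 ->
    (forall z, z < y -> exists w, w <> 0 /\ eval o f (z :: xs) w) ->
    eval o (RMin f) xs y
with evals (o : nat -> nat) : list rfun -> list nat -> list nat -> Prop :=
| evs_nil xs : evals o [] xs []
| evs_cons g gs xs v vs :
    eval o g xs v -> evals o gs xs vs -> evals o (g :: gs) xs (v :: vs).

Definition halts (o : nat -> nat) (e : rfun) (n : nat) : Prop :=
  exists v, eval o e [n] v.

Definition chi (X : subset_of_omega) : nat -> nat :=
  fun n => if X n then 1 else 0.

Definition ce_rel (o : nat -> nat) (A : nat -> Prop) : Prop :=
  exists e : rfun, forall n, A n <-> halts o e n.

Definition ce (A : nat -> Prop) : Prop := ce_rel (fun _ => 0) A.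

(** Computable bijective coding of binary strings and Cantor pairing. *)
Fixpoint code_str (s : list bool) : nat :=
  match s with
  | [] => 0
  | b :: s' => 2 * code_str s' + 1 + (if b then 1 else 0)
  end.

Definition cantor_pair (a b : nat) : nat :=
  (a + b) * (a + b + 1) / 2 + b.

Definition rel_ce_operator (Theta : list bool -> nat -> Prop) : Prop :=
  ce (fun n => exists s x, n = cantor_pair (code_str s) x /\ Theta s x).

Definition init_seg (X : subset_of_omega) (n : nat) : list bool :=
  map X (seq 0 n).

Definition apply_op (Theta : list bool -> nat -> Prop) (X : subset_of_omega)
  : nat -> Prop :=
  fun x => exists s, s = init_seg X (length s) /\ Theta s x.

Definition subset (X Y : subset_of_omega) : Prop :=
  forall n, X n = true -> Y n = true.

Definition infinite (X : subset_of_omega) : Prop :=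
  forall m, exists n, m <= n /\ X n = true.

Definition mem (X : subset_of_omega) : nat -> Prop := fun n => X n = true.

Definition join3 (o1 o2 o3 : nat -> nat) : nat -> nat :=
  fun n => match n mod 3 with
           | 0 => o1 (n / 3)
           | 1 => o2 (n / 3)
           | _ => o3 (n / 3)
           end.

(** A class [E] of subsets of omega is Sigma^1_1(B): there is a Turing
    functional [e] such that C is in E iff for some f : omega -> omega the
    computation of [e] on input 0 with oracle B (+) C (+) f diverges,
    i.e. E is the projection of a Pi^0_1(B) class of pairs (C, f). *)
Definition sigma11_rel (B : subset_of_omega) (E : subset_of_omega -> Prop)
  : Prop :=
  exists e : rfun, forall C,
    E C <-> exists f : nat -> nat, ~ halts (join3 (chi B) (chi C) f) e 0.

(* Main.v *)
(* Force with classes [{X in R : X infinite, X included in B}], where [R] is a Pi^0_1(B)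
   class whose members share an initial segment (the stem) of length [n], closed
   under subsets that keep the stem. Given an index [e] and such a class,
   either some member [X] has [W_e^X] not included in [A], and fixing enough of [X]
   forces this; or for some member [X] and some [x] in [A] no string with the given
   stem and all its elements in [X] makes [e] enumerate [x], and the members with
   this property, a Pi^0_1 condition, form a smaller class that forces
   [x] out of [W_e]; or neither happens. In the last case the class is as
   desired: for [S] included in a member, enumerate [x] whenever [e] does so along a
   string with the given stem and all further elements in [S]. If the last case never
   occurred, meeting all [e] in turn would give an infinite subset of [B] relative to
   which [A] is not c.e. *)

From Stdlib Require Import List Arith Lia Bool Cantor Classical ClassicalEpsilon.
Require Import Defs.
Import ListNotations.

(** * Structural induction on programs and an injective numbering of them *)

Lemma rfun_nested_ind (P : rfun -> Prop) :
  P RZero -> P RSucc -> (forall i, P (RProj i)) -> P ROracle ->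
  (forall f gs, P f -> Forall P gs -> P (RComp f gs)) ->
  (forall f g, P f -> P g -> P (RPrimRec f g)) ->
  (forall f, P f -> P (RMin f)) ->
  forall e, P e.
Proof.
  intros Hz Hs Hp Ho Hc Hr Hm.
  fix IH 1. intros [ | |i| |f gs|f g|f].
  - exact Hz.
  - exact Hs.
  - apply Hp.
  - exact Ho.
  - apply Hc; [apply IH|].
    (* The inner recursion on [gs] exposes each [g] as a subterm of the whole program, which makes
       the call to [IH] guarded. *)
    induction gs as [|g gs IHgs]; constructor; [apply IH|exact IHgs].
  - apply Hr; apply IH.
  - apply Hm, IH.
Qed.

(** The stages of the final construction are numbers, and stage [k] deals with the program of code
    [k] if there is one; this asks for injectivity. The successor in the fold tells nonempty lists
    from the empty one. *)
Fixpoint rfun_code (e : rfun) : nat :=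
  match e with
  | RZero => to_nat (0, 0)
  | RSucc => to_nat (1, 0)
  | RProj i => to_nat (2, i)
  | ROracle => to_nat (3, 0)
  | RComp f gs =>
      to_nat (4, to_nat (rfun_code f,
        fold_right (fun g r => S (to_nat (rfun_code g, r))) 0 gs))
  | RPrimRec f g => to_nat (5, to_nat (rfun_code f, rfun_code g))
  | RMin f => to_nat (6, rfun_code f)
  end.

Lemma to_nat_pair_inj a b c d : to_nat (a, b) = to_nat (c, d) -> a = c /\ b = d.
Proof. intros H. apply to_nat_inj in H. now injection H. Qed.

Lemma rfun_code_inj e : forall e', rfun_code e = rfun_code e' -> e = e'.
Proof.
  induction e as [ | |i| |f gs IHf IHgs|f g IHf IHg|f IHf] using rfun_nested_ind;
    intros [ | |i'| |f' gs'|f' g'|f'] H; cbn [rfun_code] in H;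
    apply to_nat_pair_inj in H as [Ht H]; try discriminate Ht; try reflexivity.
  - now subst.
  - apply to_nat_pair_inj in H as [H1 H2].
    apply IHf in H1. subst f'. f_equal.
    revert gs' H2. clear Ht. induction IHgs as [|g gs Hg _ IH]; intros [|g' gs'] H2;
      cbn [fold_right] in H2; try discriminate; auto.
    apply eq_add_S, to_nat_pair_inj in H2 as [H2 H3].
    f_equal; auto.
  - apply to_nat_pair_inj in H as [H1 H2]. f_equal; auto.
  - f_equal; auto.
Qed.

(** * A clocked evaluator *)

(* Results are coded as [0] for "undefined" and [S v] for the value [v], and
   so are the answers of the partial oracle [L]. The clock [n] only bounds
   unbounded searches. The state of a search is [0] when stuck, [1] when still
   searching, and [S (S y)] when [y] has been found. *)
Fixpoint run (n : nat) (L : nat -> nat) (e : rfun) (xs : list nat) : nat :=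
  match e with
  | RZero => 1
  | RSucc => S (S (nth 0 xs 0))
  | RProj i => S (nth i xs 0)
  | ROracle => L (nth 0 xs 0)
  | RComp f gs =>
      if forallb (fun g => negb (run n L g xs =? 0)) gs
      then run n L f (map (fun g => pred (run n L g xs)) gs) else 0
  | RPrimRec f g =>
      nat_rect (fun _ => nat) (run n L f (tl xs))
        (fun k w => if w =? 0 then 0 else run n L g (k :: pred w :: tl xs))
        (nth 0 xs 0)
  | RMin f =>
      pred (nat_rect (fun _ => nat) 1
        (fun k w => if w =? 1
                    then (if run n L f (k :: xs) =? 0 then 0 else
                          if run n L f (k :: xs) =? 1 then S (S k) else 1)
                    else w) n)
  end.

(** The oracle [L] may be silent but never wrong, so every defined result unwinds to a
    derivation. *)
Lemma run_sound (o L : nat -> nat) n :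
  (forall q w, L q = S w -> o q = w) ->
  forall e xs v, run n L e xs = S v -> eval o e xs v.
Proof.
  intros HL e.
  induction e as [ | |i| |f gs IHf IHgs|f g IHf IHg|f IHf] using rfun_nested_ind;
    intros xs v H; cbn [run] in H.
  - injection H as <-. constructor.
  - injection H as <-. constructor.
  - injection H as <-. constructor.
  - apply HL in H. subst. constructor.
  - destruct (forallb _ gs) eqn:Hgs; [|discriminate].
    econstructor; [|apply IHf; exact H].
    clear H IHf. induction IHgs as [|g gs Hg _ IH]; cbn in *; constructor.
    + apply andb_true_iff in Hgs as [H _].
      destruct (run n L g xs) eqn:E; [discriminate|auto].
    + apply IH. now apply andb_true_iff in Hgs.
  - assert (K : forall k v, nat_rect (fun _ => nat) (run n L f (tl xs))
        (fun k w => if w =? 0 then 0 else run n L g (k :: pred w :: tl xs)) k = S v ->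
        eval o (RPrimRec f g) (k :: tl xs) v).
    { clear H v. induction k as [|k IHk]; cbn [nat_rect]; intros v H.
      - constructor; auto.
      - destruct (nat_rect _ _ _ k) as [|w] eqn:E; [discriminate|].
        cbn [Nat.eqb pred] in H. econstructor; eauto. }
    apply K in H. destruct xs; cbn in *; [now constructor|exact H].
  - set (st := fun k w => if w =? 1
                    then (if run n L f (k :: xs) =? 0 then 0 else
                          if run n L f (k :: xs) =? 1 then S (S k) else 1)
                    else w) in H.
    (* Invariant of the search: in state [1] all arguments tried so far gave nonzero values, and
       [S (S y)] records [y] as the first zero. A result [1] of [run] stands for the value [0]. *)
    assert (K : forall m, let s := nat_rect (fun _ => nat) 1 st m in
       (s = 1 -> forall z, z < m -> exists w, run n L f (z :: xs) = S (S w)) /\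
       (forall y, s = S (S y) -> run n L f (y :: xs) = 1 /\
           forall z, z < y -> exists w, run n L f (z :: xs) = S (S w))).
    { induction m as [|m [IH1 IH2]]; cbn [nat_rect].
      - split; [lia|discriminate].
      - set (s := nat_rect _ _ st m) in *. cbv zeta. unfold st.
        destruct (Nat.eqb_spec s 1) as [E|E].
        + destruct (run n L f (m :: xs)) as [|[|w]] eqn:Ef; cbn.
          * split; discriminate.
          * split; [discriminate|]. intros y [= <-]. auto.
          * split; [|discriminate]. intros _ z Hz.
            destruct (Nat.eq_dec z m) as [->|]; [eauto|apply IH1; auto; lia].
        + split; [tauto|auto]. }
    destruct (K n) as [_ K2]. cbv zeta in K2.
    destruct (nat_rect _ 1 st n) as [|s]; [discriminate|].
    cbn in H. subst s. destruct (K2 v eq_refl) as [K3 K4].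
    constructor; [auto|].
    intros z Hz. destruct (K4 z Hz) as [w Hw]. exists (S w). auto.
Qed.

(** A halting computation makes finitely many queries and finitely many rounds of search. One [u]
    bounds both, since a single string will serve as oracle and as clock. *)
Lemma run_complete (o : nat -> nat) e : forall xs v, eval o e xs v ->
  exists u, forall n L, u <= n -> (forall q, q < u -> L q = S (o q)) ->
    run n L e xs = S v.
Proof.
  induction e as [ | |i| |f gs IHf IHgs|f g IHf IHg|f IHf] using rfun_nested_ind;
    intros xs v H.
  - inversion H; subst. exists 0. reflexivity.
  - inversion H; subst. exists 0. reflexivity.
  - inversion H; subst. exists 0. reflexivity.
  - inversion H; subst. exists (S (nth 0 xs 0)). intros. cbn. auto.
  - inversion H as [| | | |? ? ? ys ? Hgs Hf | | | |]; subst.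
    destruct (IHf _ _ Hf) as [u1 U1].
    assert (K : exists u, forall n L, u <= n -> (forall q, q < u -> L q = S (o q)) ->
      forallb (fun g => negb (run n L g xs =? 0)) gs = true /\
      map (fun g => pred (run n L g xs)) gs = ys).
    { clear - IHgs Hgs. revert ys Hgs.
      induction IHgs as [|g gs Hg _ IH]; intros ys Hgs; inversion Hgs as [|? ? ? w ws He Hes]; subst.
      - exists 0. auto.
      - destruct (Hg _ _ He) as [u U], (IH _ Hes) as [u' U'].
        exists (max u u'). intros n L Hn HL.
        cbn. destruct (U' n L) as [-> ->]; [lia|intros; apply HL; lia|].
        rewrite (U n L); [auto|lia|intros; apply HL; lia]. }
    destruct K as [u2 U2]. exists (max u1 u2). intros n L Hn HL. cbn [run].
    destruct (U2 n L) as [-> ->]; [lia|intros; apply HL; lia|].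
    apply U1; [lia|intros; apply HL; lia].
  - assert (K : forall ys k v, eval o (RPrimRec f g) (k :: ys) v ->
      exists u, forall n L, u <= n -> (forall q, q < u -> L q = S (o q)) ->
      nat_rect (fun _ => nat) (run n L f ys)
        (fun k w => if w =? 0 then 0 else run n L g (k :: pred w :: ys)) k = S v).
    { clear xs v H. intros xs. induction k as [|k IHk]; intros v H;
        inversion H as [| | | | |? ? ? ? H0|? ? ? ? w ? H1 H2| |]; subst.
      - apply IHf. assumption.
      - destruct (IHk _ H1) as [u1 U1], (IHg _ _ H2) as [u2 U2].
        exists (max u1 u2). intros n L Hn HL. cbn [nat_rect].
        rewrite (U1 n L); [|lia|intros; apply HL; lia].
        cbn [Nat.eqb pred].
        apply U2; [lia|intros; apply HL; lia]. }
    destruct xs as [|k ys].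
    + apply (K [] 0). now inversion H.
    + exact (K ys k v H).
  - inversion H as [| | | | | | | |? ? ? Hy Hz]; subst.
    destruct (IHf _ _ Hy) as [u1 U1].
    assert (K : forall m, m <= v -> exists u,
      forall n L, u <= n -> (forall q, q < u -> L q = S (o q)) ->
      forall z, z < m -> exists w, run n L f (z :: xs) = S (S w)).
    { induction m as [|m IHm]; intros Hm.
      - exists 0. lia.
      - destruct IHm as [u U]; [lia|].
        destruct (Hz m) as (w & Hw & He); [lia|].
        destruct (IHf _ _ He) as [u' U'].
        exists (max u u'). intros n L Hn HL z Hzm.
        destruct (Nat.eq_dec z m) as [->|].
        + exists (pred w). rewrite (U' n L); [f_equal; lia|lia|intros; apply HL; lia].
        + apply (U n L); [lia|intros; apply HL; lia|lia]. }
    destruct (K v (le_n _)) as [u2 U2].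
    exists (max (S v) (max u1 u2)). intros n L Hn HL. cbn [run].
    specialize (U1 n L ltac:(lia) ltac:(intros; apply HL; lia)).
    specialize (U2 n L ltac:(lia) ltac:(intros; apply HL; lia)).
    set (st := fun k w => if w =? 1
                    then (if run n L f (k :: xs) =? 0 then 0 else
                          if run n L f (k :: xs) =? 1 then S (S k) else 1)
                    else w).
    assert (M1 : forall m, m <= v -> nat_rect (fun _ => nat) 1 st m = 1).
    { induction m as [|m IHm]; intros Hm; [reflexivity|]. cbn [nat_rect].
      rewrite IHm by lia. destruct (U2 m) as [w Hw]; [lia|].
      unfold st. rewrite Hw. reflexivity. }
    (* Once the zero is found the state is frozen, so a longer clock changes nothing. *)
    assert (M2 : forall m, nat_rect (fun _ => nat) 1 st (S v + m) = S (S v)).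
    { induction m as [|m IHm].
      - rewrite Nat.add_0_r. cbn [nat_rect]. rewrite M1 by lia.
        unfold st. rewrite U1. reflexivity.
      - rewrite Nat.add_succ_r. cbn [nat_rect]. rewrite IHm. reflexivity. }
    replace n with (S v + (n - S v)) at 1 by lia. fold st. now rewrite M2.
Qed.

(** Both derivations are compared with the function [run] on the fully defined oracle, which
    replaces an induction on derivations. *)
Lemma eval_det o e xs v w : eval o e xs v -> eval o e xs w -> v = w.
Proof.
  intros Hv Hw.
  destruct (run_complete _ _ _ _ Hv) as [u U], (run_complete _ _ _ _ Hw) as [u' U'].
  specialize (U (max u u') (fun q => S (o q)) ltac:(lia) (fun _ _ => eq_refl)).
  specialize (U' (max u u') (fun q => S (o q)) ltac:(lia) (fun _ _ => eq_refl)).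
  congruence.
Qed.

(** * Total computable functions *)

(** Total functionals computed uniformly in the oracle. Arguments stay in a list so that the closure
    rules below apply in every arity. *)
Definition cmp (m : nat) (F : (nat -> nat) -> list nat -> nat) : Prop :=
  exists e, forall o xs, length xs = m -> eval o e xs (F o xs).

Lemma cmp_ext m F G :
  (forall o xs, length xs = m -> F o xs = G o xs) -> cmp m F -> cmp m G.
Proof.
  intros H [e He]. exists e. intros o xs Hx. rewrite <- H; auto.
Qed.

Lemma skipn_as_map (xs : list nat) j :
  skipn j xs = map (fun i => nth i xs 0) (seq j (length xs - j)).
Proof.
  revert j. induction xs as [|x xs IH]; intros j.
  - now rewrite skipn_nil.
  - destruct j as [|j].
    + cbn [skipn length Nat.sub seq map nth]. f_equal.
      specialize (IH 0). rewrite Nat.sub_0_r in IH.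
      rewrite <- seq_shift, map_map. exact IH.
    + cbn [skipn length Nat.sub]. rewrite IH, <- seq_shift, map_map. reflexivity.
Qed.

Lemma cmp_proj m i : cmp m (fun _ xs => nth i xs 0).
Proof. exists (RProj i). intros. constructor. Qed.

(** General reindexing: the first [j] arguments are replaced by the values of [Gs], and projections
    pass on the rest. *)
Lemma cmp_subst m j F Gs :
  cmp (length Gs + (m - j)) F -> Forall (cmp m) Gs ->
  cmp m (fun o xs => F o (map (fun G => G o xs) Gs ++ skipn j xs)).
Proof.
  intros [e He] HG.
  assert (K : exists es, forall o xs, length xs = m ->
    evals o es xs (map (fun G => G o xs) Gs ++ skipn j xs)).
  { clear He. induction HG as [|G Gs [g Hg] _ [es IH]].
    - exists (map RProj (seq j (m - j))). intros o xs <-. cbn [map app].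
      rewrite skipn_as_map. induction (seq _ _); repeat constructor. assumption.
    - exists (g :: es). intros o xs Hx. constructor; auto. }
  destruct K as [es Hes]. exists (RComp e es). intros o xs Hx.
  econstructor; [apply Hes, Hx|]. apply He.
  rewrite length_app, length_map, length_skipn. lia.
Qed.

Lemma cmp_const m c : cmp m (fun _ _ => c).
Proof.
  induction c as [|c [e He]].
  - exists RZero. constructor.
  - exists (RComp RSucc [e]). intros o xs Hx.
    apply (ev_comp _ _ _ _ [c]); [|exact (ev_succ o [c])].
    repeat constructor; auto.
Qed.

Lemma cmp_comp1 m (f : (nat -> nat) -> nat -> nat) F :
  cmp 1 (fun o xs => f o (nth 0 xs 0)) -> cmp m F -> cmp m (fun o xs => f o (F o xs)).
Proof.
  intros Hf HF.
  assert (Hf' : cmp (length [F] + (m - m)) (fun o xs => f o (nth 0 xs 0)))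
    by (rewrite Nat.sub_diag; exact Hf).
  apply (cmp_subst m m _ [F]) in Hf'; auto.
Qed.

Lemma cmp_comp2 m (f : nat -> nat -> nat) F G :
  cmp 2 (fun o xs => f (nth 0 xs 0) (nth 1 xs 0)) -> cmp m F -> cmp m G ->
  cmp m (fun o xs => f (F o xs) (G o xs)).
Proof.
  intros Hf HF HG.
  assert (Hf' : cmp (length [F; G] + (m - m)) (fun o xs => f (nth 0 xs 0) (nth 1 xs 0)))
    by (rewrite Nat.sub_diag; exact Hf).
  apply (cmp_subst m m _ [F; G]) in Hf'; auto.
Qed.

Lemma cmp_succ m F : cmp m F -> cmp m (fun o xs => S (F o xs)).
Proof.
  apply (cmp_comp1 m (fun _ => S)). exists RSucc. intros. constructor.
Qed.

Lemma cmp_oracle m F : cmp m F -> cmp m (fun o xs => o (F o xs)).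
Proof.
  apply (cmp_comp1 m (fun o => o)). exists ROracle. intros. constructor.
Qed.

(** [RPrimRec] puts the counter and the previous value in front of the parameters, hence [skipn 2]
    in the hypothesis on the step; the bound [n] is substituted afterwards. *)
Lemma cmp_rec m a b n :
  cmp m a ->
  cmp (2 + m) (fun o ys => b o (nth 0 ys 0) (nth 1 ys 0) (skipn 2 ys)) ->
  cmp m n ->
  cmp m (fun o xs => nat_rect (fun _ => nat) (a o xs) (fun k w => b o k w xs) (n o xs)).
Proof.
  intros [ea Ha] [eb Hb] Hn.
  assert (K : cmp (S m) (fun o ys => nat_rect (fun _ => nat) (a o (skipn 1 ys))
              (fun k w => b o k w (skipn 1 ys)) (nth 0 ys 0))).
  { exists (RPrimRec ea eb). intros o [|k xs] Hx; [discriminate|].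
    injection Hx as Hx. cbn [nth skipn].
    induction k as [|k IH]; cbn [nat_rect].
    - constructor. auto.
    - econstructor; [exact IH|]. apply (Hb o (_ :: _ :: _)). cbn. lia. }
  assert (K' : cmp (length [n] + (m - 0)) (fun o ys => nat_rect (fun _ => nat) (a o (skipn 1 ys))
              (fun k w => b o k w (skipn 1 ys)) (nth 0 ys 0)))
    by (rewrite Nat.sub_0_r; exact K).
  apply (cmp_subst m 0 _ [n]) in K'; auto.
Qed.

Lemma cmp_rec2 (a : nat -> nat) (b : nat -> nat -> nat -> nat) :
  cmp 1 (fun _ xs => a (nth 0 xs 0)) ->
  cmp 3 (fun _ xs => b (nth 0 xs 0) (nth 1 xs 0) (nth 2 xs 0)) ->
  cmp 2 (fun _ xs => nat_rect (fun _ => nat) (a (nth 1 xs 0))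
                       (fun k w => b k w (nth 1 xs 0)) (nth 0 xs 0)).
Proof.
  intros Ha Hb.
  apply (cmp_rec 2 (fun _ xs => a (nth 1 xs 0)) (fun _ k w xs => b k w (nth 1 xs 0))
           (fun _ xs => nth 0 xs 0)).
  - apply (cmp_comp1 2 (fun _ => a)); [exact Ha|apply cmp_proj].
  (* The list here is counter, previous value, bound, parameter; position 2, the bound, is left
     out. *)
  - change 3 with (length [fun (_ : nat -> nat) xs => nth 0 xs 0;
                           fun _ xs => nth 1 xs 0; fun _ xs => nth 3 xs 0] + (4 - 4)) in Hb.
    apply cmp_subst in Hb; [|repeat constructor; apply cmp_proj].
    eapply cmp_ext; [|exact Hb].
    intros o [|x0 [|x1 [|x2 [|x3 xs]]]] Hx; try discriminate. reflexivity.
  - apply cmp_proj.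
Qed.

Lemma cmp_pred m F : cmp m F -> cmp m (fun o xs => pred (F o xs)).
Proof.
  apply (cmp_comp1 m (fun _ => pred)).
  apply (cmp_ext 1 (fun _ xs => nat_rect (fun _ => nat) 0 (fun k _ => k) (nth 0 xs 0))).
  - intros o xs _. now destruct (nth 0 xs 0).
  - apply (cmp_rec 1 (fun _ _ => 0) (fun _ k _ _ => k) (fun _ xs => nth 0 xs 0));
      first [apply cmp_const | apply cmp_proj].
Qed.

Lemma cmp_add m F G : cmp m F -> cmp m G -> cmp m (fun o xs => F o xs + G o xs).
Proof.
  apply cmp_comp2.
  apply (cmp_ext 2 (fun _ xs => nat_rect (fun _ => nat) (nth 1 xs 0)
                     (fun _ w => S w) (nth 0 xs 0))).
  - intros o xs _. induction (nth 0 xs 0); cbn in *; auto.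
  - apply (cmp_rec2 (fun x => x) (fun _ w _ => S w));
      [|apply cmp_succ]; apply cmp_proj.
Qed.

Lemma cmp_mul m F G : cmp m F -> cmp m G -> cmp m (fun o xs => F o xs * G o xs).
Proof.
  apply cmp_comp2.
  apply (cmp_ext 2 (fun _ xs => nat_rect (fun _ => nat) 0
                     (fun _ w => nth 1 xs 0 + w) (nth 0 xs 0))).
  - intros o xs _. induction (nth 0 xs 0); cbn in *; auto.
  - apply (cmp_rec2 (fun x => 0) (fun _ w x => x + w));
      [apply cmp_const|apply cmp_add; apply cmp_proj].
Qed.

Lemma cmp_sub m F G : cmp m F -> cmp m G -> cmp m (fun o xs => F o xs - G o xs).
Proof.
  (* Recursion runs on the first argument, which has to be the subtrahend. *)
  intros HF HG. revert HG HF.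
  apply (cmp_comp2 m (fun y x => x - y)).
  apply (cmp_ext 2 (fun _ xs => nat_rect (fun _ => nat) (nth 1 xs 0)
                     (fun _ w => pred w) (nth 0 xs 0))).
  - intros o xs _. induction (nth 0 xs 0); cbn [nat_rect]; lia.
  - apply (cmp_rec2 (fun x => x) (fun _ w _ => pred w));
      [|apply cmp_pred]; apply cmp_proj.
Qed.

Definition cmpb (m : nat) (P : (nat -> nat) -> list nat -> bool) : Prop :=
  cmp m (fun o xs => Nat.b2n (P o xs)).

Lemma cmpb_ext m P Q :
  (forall o xs, length xs = m -> P o xs = Q o xs) -> cmpb m P -> cmpb m Q.
Proof.
  intros H. apply cmp_ext. intros o xs Hx. now rewrite H.
Qed.

Lemma cmpb_true m : cmpb m (fun _ _ => true).
Proof. exact (cmp_const m 1). Qed.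

Lemma cmpb_negb m P : cmpb m P -> cmpb m (fun o xs => negb (P o xs)).
Proof.
  intros H. apply (cmp_ext m (fun o xs => 1 - Nat.b2n (P o xs))).
  - intros o xs _. now destruct (P o xs).
  - apply cmp_sub; [apply cmp_const|exact H].
Qed.

Lemma cmpb_andb m P Q : cmpb m P -> cmpb m Q -> cmpb m (fun o xs => P o xs && Q o xs).
Proof.
  intros HP HQ. apply (cmp_ext m (fun o xs => Nat.b2n (P o xs) * Nat.b2n (Q o xs))).
  - intros o xs _. now destruct (P o xs), (Q o xs).
  - apply cmp_mul; assumption.
Qed.

Lemma cmpb_implb m P Q : cmpb m P -> cmpb m Q -> cmpb m (fun o xs => implb (P o xs) (Q o xs)).
Proof.
  intros HP HQ. apply (cmpb_ext m (fun o xs => negb (P o xs && negb (Q o xs)))).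
  - intros o xs _. now destruct (P o xs), (Q o xs).
  - apply cmpb_negb, cmpb_andb, cmpb_negb; assumption.
Qed.

Lemma cmpb_leb m F G : cmp m F -> cmp m G -> cmpb m (fun o xs => F o xs <=? G o xs).
Proof.
  intros HF HG. apply (cmp_ext m (fun o xs => 1 - (F o xs - G o xs))).
  - intros o xs _. destruct (Nat.leb_spec (F o xs) (G o xs)); cbn [Nat.b2n]; lia.
  - repeat apply cmp_sub; auto. apply cmp_const.
Qed.

Lemma cmpb_eqb m F G : cmp m F -> cmp m G -> cmpb m (fun o xs => F o xs =? G o xs).
Proof.
  intros HF HG. apply (cmpb_ext m (fun o xs => (F o xs <=? G o xs) && (G o xs <=? F o xs))).
  - intros o xs _. destruct (Nat.leb_spec (F o xs) (G o xs)),
      (Nat.leb_spec (G o xs) (F o xs)), (Nat.eqb_spec (F o xs) (G o xs)); cbn; auto; lia.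
  - apply cmpb_andb; apply cmpb_leb; assumption.
Qed.

Lemma cmp_if m P F G : cmpb m P -> cmp m F -> cmp m G ->
  cmp m (fun o xs => if P o xs then F o xs else G o xs).
Proof.
  intros HP HF HG.
  apply (cmp_ext m (fun o xs => Nat.b2n (P o xs) * F o xs + Nat.b2n (negb (P o xs)) * G o xs)).
  - intros o xs _. destruct (P o xs); cbn; lia.
  - apply cmp_add; apply cmp_mul; auto. now apply cmpb_negb.
Qed.

Lemma cmpb_forallb m (P : (nat -> nat) -> nat -> list nat -> bool) n :
  cmpb (S m) (fun o ys => P o (nth 0 ys 0) (skipn 1 ys)) -> cmp m n ->
  cmpb m (fun o xs => forallb (fun k => P o k xs) (seq 0 (n o xs))).
Proof.
  intros HP Hn.
  apply (cmp_ext m (fun o xs => nat_rect (fun _ => nat) 1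
           (fun k w => Nat.b2n (P o k xs) * w) (n o xs))).
  - intros o xs _. induction (n o xs) as [|k IH]; [reflexivity|].
    cbn [nat_rect]. rewrite IH, seq_S, forallb_app. cbn [forallb Nat.add].
    destruct (P o k xs), (forallb _ (seq 0 k)); reflexivity.
  - apply (cmp_rec m (fun _ _ => 1) (fun o k w xs => Nat.b2n (P o k xs) * w) n);
      [apply cmp_const| |exact Hn].
    apply cmp_mul; [|apply cmp_proj].
    (* [P] expects the counter followed by the parameters, so the running product at position 1 is
       dropped. *)
    assert (HP' : cmp (length [fun (_ : nat -> nat) xs => nth 0 xs 0] + (2 + m - 2))
        (fun o ys => Nat.b2n (P o (nth 0 ys 0) (skipn 1 ys))))
      by (replace (_ + _) with (S m) by (cbn; lia); exact HP).
    apply (cmp_subst (2 + m) 2) in HP'; [exact HP'|]. constructor; [|constructor].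
    apply cmp_proj.
Qed.

Lemma cmpb_existsb m (P : (nat -> nat) -> nat -> list nat -> bool) n :
  cmpb (S m) (fun o ys => P o (nth 0 ys 0) (skipn 1 ys)) -> cmp m n ->
  cmpb m (fun o xs => existsb (fun k => P o k xs) (seq 0 (n o xs))).
Proof.
  intros HP Hn.
  apply (cmpb_ext m (fun o xs => negb (forallb (fun k => negb (P o k xs)) (seq 0 (n o xs))))).
  - intros o xs _. induction (seq 0 (n o xs)) as [|k l IH]; [reflexivity|].
    cbn. rewrite <- IH. now destruct (P o k xs).
  - apply cmpb_negb, (cmpb_forallb m (fun o k xs => negb (P o k xs))); [|exact Hn].
    now apply cmpb_negb.
Qed.

(** Half of [n], rounded down, counts the odd numbers below [n]. *)
Lemma cmp_div2 m F : cmp m F -> cmp m (fun o xs => Nat.div2 (F o xs)).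
Proof.
  apply (cmp_comp1 m (fun _ => Nat.div2)).
  set (odd := fun n => nat_rect (fun _ => nat) 0 (fun _ w => 1 - w) n).
  apply (cmp_ext 1 (fun _ xs => nat_rect (fun _ => nat) 0 (fun k w => w + odd k) (nth 0 xs 0))).
  - intros o xs _.
    assert (K : forall n, nat_rect (fun _ => nat) 0 (fun k w => w + odd k) n = Nat.div2 n /\
                  n = 2 * Nat.div2 n + odd n /\ odd n <= 1).
    { induction n as [|n (I1 & I2 & I3)]; [cbn; lia|].
      change (odd (S n)) with (1 - odd n). cbn [nat_rect]. rewrite I1.
      assert (D : Nat.div2 (S n) = Nat.div2 n + odd n); [|lia].
      assert (odd n = 0 \/ odd n = 1) as [E|E] by lia; rewrite E in *.
      - replace n with (2 * Nat.div2 n) at 1 by lia. rewrite Nat.div2_succ_double. lia.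
      - replace (S n) with (2 * S (Nat.div2 n)) by lia. rewrite Nat.div2_double. lia. }
    apply K.
  - apply (cmp_rec 1 (fun _ _ => 0) (fun _ k w _ => w + odd k) (fun _ xs => nth 0 xs 0));
      [apply cmp_const| |apply cmp_proj].
    apply cmp_add; [apply cmp_proj|].
    apply (cmp_rec 3 (fun _ _ => 0) (fun _ _ w _ => 1 - w) (fun _ xs => nth 0 xs 0));
      [apply cmp_const| |apply cmp_proj].
    apply cmp_sub; [apply cmp_const|apply cmp_proj].
Qed.

(** * Unbounded search and c.e. sets *)

Lemma halts_min o f F x :
  (forall y, eval o f [y; x] (F y)) ->
  halts o (RMin f) x <-> exists y, F y = 0.
Proof.
  intros Hf. split.
  - intros [y Hy]. inversion Hy; subst. exists y. eapply eval_det; eauto.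
  - intros [y Hy].
    assert (K : exists z, F z = 0 /\ forall t, t < z -> F t <> 0).
    { induction y as [y IH] using lt_wf_ind.
      destruct (classic (exists t, t < y /\ F t = 0)) as [(t & Ht & E)|N].
      - eauto.
      - exists y. split; auto. intros t Ht E. apply N. eauto. }
    destruct K as (z & Hz & Hlt). exists z. constructor.
    + rewrite <- Hz. auto.
    + intros t Ht. exists (F t). auto.
Qed.

Lemma ce_search P :
  cmpb 2 (fun _ xs => P (nth 0 xs 0) (nth 1 xs 0)) ->
  ce (fun n => exists c, P c n = true).
Proof.
  (* [RMin] looks for a zero, hence the negation. *)
  intros H. apply cmpb_negb in H. destruct H as [e He].
  exists (RMin e). intros n.
  rewrite (halts_min _ _ (fun c => Nat.b2n (negb (P c n)))).
  - split; intros [c Hc]; exists c.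
    + now rewrite Hc.
    + now destruct (P c n).
  - intros y. exact (He _ [y; n] eq_refl).
Qed.

(** * Binary strings coded as numbers *)

(* [bit c q] is [0] past the end of the string coded by [c], and [S b] when its
   [q]-th entry is [b]. *)
Definition tail (c : nat) : nat := Nat.div2 (pred c).

Definition bit (c q : nat) : nat :=
  let d := nat_rect (fun _ => nat) c (fun _ w => tail w) q in
  if d =? 0 then 0 else d - 2 * tail d.

Lemma cmp_bit m F G : cmp m F -> cmp m G -> cmp m (fun o xs => bit (F o xs) (G o xs)).
Proof.
  intros HF HG. revert HG HF. apply (cmp_comp2 m (fun q c => bit c q)).
  assert (Ht : forall m F, cmp m F -> cmp m (fun o xs => tail (F o xs)))
    by (intros; now apply cmp_div2, cmp_pred).
  assert (Hd : cmp 2 (fun _ xs => nat_rect (fun _ => nat) (nth 1 xs 0) (fun _ w => tail w)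
                       (nth 0 xs 0))).
  { apply (cmp_rec2 (fun x => x) (fun _ w _ => tail w)); [|apply Ht]; apply cmp_proj. }
  apply cmp_if; [apply cmpb_eqb; [exact Hd|apply cmp_const]|apply cmp_const|].
  apply cmp_sub; [exact Hd|]. apply cmp_mul; [apply cmp_const|apply Ht, Hd].
Qed.

(** [code_str] is base-two notation with digits 1 and 2, lowest digit first; halving the predecessor
    removes the lowest digit. *)
Lemma tail_code b s : tail (code_str (b :: s)) = code_str s.
Proof.
  unfold tail. cbn [code_str].
  destruct b.
  - replace (pred _) with (S (2 * code_str s)) by lia. apply Nat.div2_succ_double.
  - replace (pred _) with (2 * code_str s) by lia. apply Nat.div2_double.
Qed.

Lemma bit_tail c q : bit c (S q) = bit (tail c) q.
Proof.
  unfold bit.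
  replace (nat_rect (fun _ => nat) c (fun _ w => tail w) (S q))
    with (nat_rect (fun _ => nat) (tail c) (fun _ w => tail w) q); [reflexivity|].
  cbn [nat_rect]. induction q; cbn in *; congruence.
Qed.

Lemma bit_code s q :
  bit (code_str s) q = match nth_error s q with Some b => S (Nat.b2n b) | None => 0 end.
Proof.
  revert s. induction q as [|q IH]; intros s.
  - destruct s as [|b s]; [reflexivity|]. cbn [nth_error].
    unfold bit. cbn [nat_rect]. rewrite tail_code. cbn [code_str].
    destruct (Nat.eqb_spec (2 * code_str s + 1 + (if b then 1 else 0)) 0); [lia|].
    destruct b; cbn [Nat.b2n]; lia.
  - rewrite bit_tail. destruct s as [|b s].
    + change (tail (code_str [])) with (code_str []). rewrite IH. now destruct q.
    + now rewrite tail_code, IH.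
Qed.

(** Allows quantifiers over strings to be replaced by quantifiers over numbers. *)
Lemma code_surj c : exists s, code_str s = c.
Proof.
  induction c as [c IH] using lt_wf_ind.
  destruct c as [|c]; [now exists []|].
  destruct (IH (Nat.div2 c)) as [s Hs]; [pose proof (Nat.div2_decr c c); lia|].
  exists (Nat.odd c :: s). cbn [code_str]. rewrite Hs.
  pose proof (Nat.div2_odd c) as E. unfold Nat.b2n in E. lia.
Qed.

Lemma code_length s : length s <= code_str s.
Proof. induction s; cbn [length code_str]; lia. Qed.

(** Turns a quantifier over the positions of a coded string into a bounded one. *)
Lemma bit_lt c q : bit c q <> 0 -> q < c.
Proof.
  destruct (code_surj c) as [s <-]. rewrite bit_code.
  pose proof (code_length s). destruct (nth_error s q) eqn:E; [|tauto].
  assert (q < length s) by (apply nth_error_Some; congruence). lia.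
Qed.

Lemma bit_cases c q : bit c q = 0 \/ bit c q = 1 \/ bit c q = 2.
Proof.
  destruct (code_surj c) as [s <-]. rewrite bit_code.
  destruct (nth_error s q) as [[]|]; cbn; auto.
Qed.

Lemma bit_init_seg X k q :
  bit (code_str (init_seg X k)) q = if q <? k then S (chi X q) else 0.
Proof.
  rewrite bit_code. unfold init_seg.
  rewrite nth_error_map.
  destruct (Nat.ltb_spec q k).
  - rewrite nth_error_nth' with (d := 0) by now rewrite length_seq.
    rewrite seq_nth by assumption. reflexivity.
  - replace (nth_error _ q) with (@None nat); [reflexivity|].
    symmetry. apply nth_error_None. now rewrite length_seq.
Qed.

(* The string coded by [c] serves both as the oracle and as the clock. *)
Definition runs (e : rfun) (c x : nat) : bool := negb (run c (bit c) e [x] =? 0).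

Lemma runs_sound e c x X :
  (forall q, bit c q <> 0 -> bit c q = 1 + chi X q) ->
  runs e c x = true -> halts (chi X) e x.
Proof.
  intros Hc H. unfold runs in H.
  destruct (run c (bit c) e [x]) as [|v] eqn:E; [discriminate|].
  exists v. eapply run_sound; [|exact E].
  intros q w Hq. specialize (Hc q). lia.
Qed.

(** The code of a string is at least its length, so a long enough initial segment is also a
    sufficient clock. *)
Lemma runs_complete e x X :
  halts (chi X) e x ->
  exists u, forall k, u <= k -> runs e (code_str (init_seg X k)) x = true.
Proof.
  intros [v Hv]. destruct (run_complete _ _ _ _ Hv) as [u U].
  exists u. intros k Hk. unfold runs. rewrite U; [reflexivity| |].
  - pose proof (code_length (init_seg X k)) as H.
    unfold init_seg in H at 1. rewrite length_map, length_seq in H. lia.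
  - intros q Hq. rewrite bit_init_seg. destruct (Nat.ltb_spec q k); [reflexivity|lia].
Qed.

(** As [e] is fixed, induction on [e] unfolds [run] into finitely many uses of the closure rules.
    The code, at position 0, is carried along as a parameter. *)
Lemma cmp_run e : forall m,
  cmp (S m) (fun _ ys => run (nth 0 ys 0) (bit (nth 0 ys 0)) e (skipn 1 ys)).
Proof.
  induction e as [ | |i| |f gs IHf IHgs|f g IHf IHg|f IHf] using rfun_nested_ind;
    intros m; cbn [run].
  - apply cmp_const.
  - apply (cmp_ext _ (fun _ ys => S (S (nth 1 ys 0)))).
    + intros o [|c ys] H; [discriminate|reflexivity].
    + apply cmp_succ, cmp_succ, cmp_proj.
  - apply (cmp_ext _ (fun _ ys => S (nth (S i) ys 0))).
    + intros o [|c ys] H; [discriminate|reflexivity].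
    + apply cmp_succ, cmp_proj.
  - apply (cmp_ext _ (fun _ ys => bit (nth 0 ys 0) (nth 1 ys 0))).
    + intros o [|c ys] H; [discriminate|reflexivity].
    + apply cmp_bit; apply cmp_proj.
  - apply cmp_if; [| |apply cmp_const].
    + clear IHf. induction IHgs as [|g gs Hg _ IH]; cbn [forallb].
      * apply cmpb_true.
      * apply cmpb_andb; [|exact IH]. apply cmpb_negb, cmpb_eqb; [apply Hg|apply cmp_const].
    + set (R := fun g => fun (_ : nat -> nat) ys =>
        pred (run (nth 0 ys 0) (bit (nth 0 ys 0)) g (skipn 1 ys))).
      specialize (IHf (length gs)).
      replace (S (length gs))
        with (length ((fun _ ys => nth 0 ys 0) :: map R gs) + (S m - S m)) in IHf
        by (cbn [length]; rewrite length_map; lia).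
      apply (cmp_subst (S m)) in IHf.
      * eapply cmp_ext; [|exact IHf]. intros o ys Hy.
        rewrite <- Hy, skipn_all, app_nil_r. cbn [map nth skipn]. rewrite map_map. reflexivity.
      * constructor; [apply cmp_proj|]. apply Forall_map.
        eapply Forall_impl; [|exact IHgs]. intros g Hg. apply cmp_pred, Hg.
  - apply (cmp_rec (S m)
      (fun _ ys => run (nth 0 ys 0) (bit (nth 0 ys 0)) f (tl (skipn 1 ys)))
      (fun _ k w ys => if w =? 0 then 0 else
         run (nth 0 ys 0) (bit (nth 0 ys 0)) g (k :: pred w :: tl (skipn 1 ys)))
      (fun _ ys => nth 0 (skipn 1 ys) 0)).
    (* Truncated subtraction also covers [m = 0], where the tail of the empty argument list is
       empty. *)
    + specialize (IHf (m - 1)).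
      replace (S (m - 1)) with (length [fun (_ : nat -> nat) ys => nth 0 ys 0] + (S m - 2)) in IHf
        by (cbn [length]; lia).
      apply cmp_subst in IHf; [|repeat constructor; apply cmp_proj].
      eapply cmp_ext; [|exact IHf].
      intros o [|c [|n ys]] Hy; try discriminate; reflexivity.
    + apply cmp_if; [apply cmpb_eqb; [apply cmp_proj|apply cmp_const]|apply cmp_const|].
      specialize (IHg (2 + (m - 1))).
      replace (S (2 + (m - 1))) with (length
        [fun (_ : nat -> nat) ys => nth 2 ys 0; fun _ ys => nth 0 ys 0;
         fun _ ys => pred (nth 1 ys 0)] + (2 + S m - 4)) in IHg
        by (cbn [length]; lia).
      apply cmp_subst in IHg.
      * eapply cmp_ext; [|exact IHg].
        intros o [|k [|w [|c [|n ys]]]] Hy; try discriminate; reflexivity.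
      * repeat constructor; try apply cmp_pred; apply cmp_proj.
    + apply (cmp_ext _ (fun _ ys => nth 1 ys 0)); [|apply cmp_proj].
      intros o [|c ys] H; [discriminate|reflexivity].
  - apply cmp_pred.
    apply (cmp_rec (S m) (fun _ _ => 1)
      (fun _ k w ys => if w =? 1 then
         (if run (nth 0 ys 0) (bit (nth 0 ys 0)) f (k :: skipn 1 ys) =? 0 then 0 else
          if run (nth 0 ys 0) (bit (nth 0 ys 0)) f (k :: skipn 1 ys) =? 1 then S (S k) else 1)
         else w)
      (fun _ ys => nth 0 ys 0)); [apply cmp_const| |apply cmp_proj].
    assert (K : cmp (2 + S m) (fun _ ys =>
      run (nth 0 (skipn 2 ys) 0) (bit (nth 0 (skipn 2 ys) 0)) f
        (nth 0 ys 0 :: skipn 1 (skipn 2 ys)))).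
    { specialize (IHf (S m)).
      replace (S (S m)) with (length
        [fun (_ : nat -> nat) ys => nth 2 ys 0; fun _ ys => nth 0 ys 0] + (2 + S m - 3)) in IHf
        by (cbn [length]; lia).
      apply cmp_subst in IHf; [|repeat constructor; apply cmp_proj].
      eapply cmp_ext; [|exact IHf].
      intros o [|k [|w [|c ys]]] Hy; try discriminate; reflexivity. }
    apply cmp_if; [apply cmpb_eqb; [apply cmp_proj|apply cmp_const]| |apply cmp_proj].
    apply cmp_if; [apply cmpb_eqb; [exact K|apply cmp_const]|apply cmp_const|].
    apply cmp_if; [apply cmpb_eqb; [exact K|apply cmp_const]| |apply cmp_const].
    apply cmp_succ, cmp_succ, cmp_proj.
Qed.

Lemma cmpb_runs m e F G :
  cmp m F -> cmp m G -> cmpb m (fun o xs => runs e (F o xs) (G o xs)).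
Proof.
  intros HF HG. apply cmpb_negb, cmpb_eqb; [|apply cmp_const].
  apply (cmp_comp2 m (fun c x => run c (bit c) e [x])); auto.
  eapply cmp_ext; [|exact (cmp_run e 1)].
  intros o [|c [|x [|]]] H; try discriminate. reflexivity.
Qed.

(** * Classes of sets *)

(** The tests read the three-part oracle of [sigma11_rel], so that a test of a witness [f] can be
    joined to them; quantifying over [f] keeps [R] independent of it. *)
Definition pi01 (B : subset_of_omega) (R : subset_of_omega -> Prop) : Prop :=
  exists P, cmpb 1 (fun o xs => P o (nth 0 xs 0)) /\
    forall C f, R C <-> forall n, P (join3 (chi B) (chi C) f) n = true.

Lemma join3_0 a b c n : join3 a b c (3 * n) = a n.
Proof.
  unfold join3. rewrite (Nat.mul_comm 3), Nat.Div0.mod_mul, Nat.div_mul; auto.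
Qed.

Lemma join3_1 a b c n : join3 a b c (3 * n + 1) = b n.
Proof.
  unfold join3. rewrite (Nat.mul_comm 3), Nat.add_comm, Nat.Div0.mod_add, Nat.div_add; auto.
Qed.

Lemma join3_2 a b c n : join3 a b c (3 * n + 2) = c n.
Proof.
  unfold join3. rewrite (Nat.mul_comm 3), Nat.add_comm, Nat.Div0.mod_add, Nat.div_add; auto.
Qed.

Lemma cmp_join_index m k F : cmp m F -> cmp m (fun o xs => o (3 * F o xs + k)).
Proof.
  intros H. apply cmp_oracle, cmp_add; [|apply cmp_const].
  apply cmp_mul; [apply cmp_const|exact H].
Qed.

Lemma chi_eqb X n : (chi X n =? 1) = X n.
Proof. unfold chi. now destruct (X n). Qed.

Lemma pi01_true B : pi01 B (fun _ => True).
Proof.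
  exists (fun _ _ => true). split; [apply cmpb_true|]. tauto.
Qed.

Lemma pi01_and B R R' : pi01 B R -> pi01 B R' -> pi01 B (fun C => R C /\ R' C).
Proof.
  intros (P & HP & H) (P' & HP' & H').
  exists (fun o n => P o n && P' o n). split; [now apply cmpb_andb|].
  intros C f. rewrite (H C f), (H' C f). split.
  - intros [K K'] n. now rewrite K, K'.
  - intros K. split; intros n; specialize (K n); now apply andb_true_iff in K.
Qed.

Definition agree (n : nat) (X Y : subset_of_omega) : Prop :=
  forall q, q < n -> X q = Y q.

Lemma agree_trans n X Y Z : agree n X Y -> agree n Y Z -> agree n X Z.
Proof. intros H K q Hq. rewrite H; auto. Qed.

Lemma agree_le m n X Y : m <= n -> agree n X Y -> agree m X Y.
Proof. intros H K q Hq. apply K. lia. Qed.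

(** [X] is no part of the oracle, but its first [n] bits enter the program as one numerical
    constant. *)
Lemma pi01_agree B n X : pi01 B (agree n X).
Proof.
  exists (fun o q => implb (negb (bit (code_str (init_seg X n)) q =? 0))
                     (bit (code_str (init_seg X n)) q =? 1 + o (3 * q + 1))).
  split.
  - apply cmpb_implb; [apply cmpb_negb|]; apply cmpb_eqb; try apply cmp_const;
      [apply cmp_bit..|apply cmp_add]; try apply cmp_const; try apply cmp_proj.
    apply cmp_join_index, cmp_proj.
  - intros C f. split; intros H q; specialize (H q).
    + rewrite bit_init_seg, join3_1. destruct (Nat.ltb_spec q n) as [L|]; [|reflexivity].
      unfold chi. rewrite (H L). apply Nat.eqb_refl.
    + intros L. rewrite bit_init_seg, join3_1 in H.
      destruct (Nat.ltb_spec q n); [|lia]. unfold chi in H.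
      destruct (X q), (C q); cbn in H; congruence.
Qed.

(** These are the codes of initial segments, of length at least [n], of the subsets of [C] that keep
    its first [n] bits. *)
Definition fits (n : nat) (C : subset_of_omega) (c : nat) : Prop :=
  forall q, (bit c q = 2 -> C q = true) /\ (q < n -> bit c q = 1 + chi C q).

(** Only positions below [c + n] matter for [fits], so it is decidable in [C], and the quantifier
    over [c] is the only unbounded one. *)
Lemma pi01_never_runs B n e x :
  pi01 B (fun C => forall c, fits n C c -> runs e c x = false).
Proof.
  exists (fun o c => implb
    (forallb (fun q => implb (bit c q =? 2) (o (3 * q + 1) =? 1) &&
                       implb (S q <=? n) (bit c q =? 1 + o (3 * q + 1)))
             (seq 0 (c + n)))
    (negb (runs e c x))).
  split.
  - apply cmpb_implb; [|apply cmpb_negb, cmpb_runs; [apply cmp_proj|apply cmp_const]].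
    assert (K : cmp 2 (fun _ ys => bit (nth 1 ys 0) (nth 0 ys 0)))
      by (apply cmp_bit; apply cmp_proj).
    assert (J : cmp 2 (fun o ys => o (3 * nth 0 ys 0 + 1)))
      by (apply cmp_join_index, cmp_proj).
    apply (cmpb_forallb 1 (fun o q xs =>
      implb (bit (nth 0 xs 0) q =? 2) (o (3 * q + 1) =? 1) &&
      implb (S q <=? n) (bit (nth 0 xs 0) q =? 1 + o (3 * q + 1)))
      (fun _ xs => nth 0 xs 0 + n)).
    + eapply cmpb_ext with (P := fun o ys =>
        implb (bit (nth 1 ys 0) (nth 0 ys 0) =? 2) (o (3 * nth 0 ys 0 + 1) =? 1) &&
        implb (S (nth 0 ys 0) <=? n)
          (bit (nth 1 ys 0) (nth 0 ys 0) =? 1 + o (3 * nth 0 ys 0 + 1))).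
      * intros o [|q [|c ys]] Hy; try discriminate. reflexivity.
      * apply cmpb_andb; apply cmpb_implb.
        -- apply cmpb_eqb; [exact K|apply cmp_const].
        -- apply cmpb_eqb; [exact J|apply cmp_const].
        -- apply cmpb_leb; [apply cmp_succ, cmp_proj|apply cmp_const].
        -- apply cmpb_eqb; [exact K|apply cmp_succ, J].
    + apply cmp_add; [apply cmp_proj|apply cmp_const].
  - intros C f.
    assert (E : forall c, forallb
        (fun q => implb (bit c q =? 2) (join3 (chi B) (chi C) f (3 * q + 1) =? 1) &&
          implb (S q <=? n) (bit c q =? 1 + join3 (chi B) (chi C) f (3 * q + 1)))
        (seq 0 (c + n)) = true <-> fits n C c).
    { intros c. rewrite forallb_forall. split; intros H q.
      - destruct (le_lt_dec (c + n) q) as [L|L].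
        + split; [|lia]. intros Hb. pose proof (bit_lt c q). lia.
        + specialize (H q ltac:(apply in_seq; lia)).
          rewrite join3_1, chi_eqb in H. apply andb_true_iff in H as [H1 H2]. split.
          * intros Hb. rewrite Hb in H1. exact H1.
          * intros Hq. replace (S q <=? n) with true in H2
              by (symmetry; now apply Nat.leb_le).
            now apply Nat.eqb_eq.
      - intros _. rewrite join3_1, chi_eqb. destruct (H q) as [H1 H2].
        apply andb_true_iff. split.
        + destruct (Nat.eqb_spec (bit c q) 2); [|reflexivity]. auto.
        + destruct (Nat.leb_spec (S q) n); [|reflexivity]. apply Nat.eqb_eq. auto. }
    split; intros H c; specialize (H c); rewrite <- (E c) in *;
      destruct (forallb _ _); cbn [implb] in *; auto.
    + now rewrite H.
    + intros _. now destruct (runs e c x).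
    + discriminate.
Qed.

(** The existential witness [f] certifies infinity: [f n] is an element of the set that is at least
    [n]. All remaining clauses are tested at each [n], and the program searches for a failure, so it
    diverges exactly when none exists. *)
Lemma sigma11_infinite_subsets B R : pi01 B R ->
  sigma11_rel B (fun C => (subset C B /\ infinite C) /\ R C).
Proof.
  intros (P & HP & HR).
  set (Q := fun o n => P o n &&
    (implb (o (3 * n + 1) =? 1) (o (3 * n) =? 1) &&
     ((n <=? o (3 * n + 2)) && (o (3 * o (3 * n + 2) + 1) =? 1)))).
  assert (HQ : cmp 2 (fun o xs => Nat.b2n (Q o (nth 0 xs 0)))).
  { apply (cmp_comp1 2 (fun o n => Nat.b2n (Q o n))); [|apply cmp_proj].
    apply (cmpb_andb 1); [exact HP|].
    pose proof (fun k => cmp_join_index 1 k _ (cmp_proj 1 0)) as J.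
    apply cmpb_andb; [apply cmpb_implb; apply cmpb_eqb; [apply J|apply cmp_const| |apply cmp_const]|].
    - apply cmp_oracle, cmp_mul; [apply cmp_const|apply cmp_proj].
    - apply cmpb_andb; [apply cmpb_leb; [apply cmp_proj|apply J]|].
      apply cmpb_eqb; [apply (cmp_join_index 1 1), J|apply cmp_const]. }
  destruct HQ as [e He]. exists (RMin e). intros C.
  assert (HE : forall f, ~ halts (join3 (chi B) (chi C) f) (RMin e) 0 <->
             forall n, Q (join3 (chi B) (chi C) f) n = true).
  { intros f. rewrite (halts_min _ _ (fun n => Nat.b2n (Q (join3 (chi B) (chi C) f) n))).
    - split.
      + intros H n. destruct (Q _ n) eqn:E; [reflexivity|].
        destruct H. exists n. now rewrite E.
      + intros H [n Hn]. now rewrite H in Hn.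
    - intros y. exact (He _ [y; 0] eq_refl). }
  assert (HQE : forall f n, Q (join3 (chi B) (chi C) f) n = true <->
    P (join3 (chi B) (chi C) f) n = true /\ (C n = true -> B n = true) /\
    n <= f n /\ C (f n) = true).
  { intros f n. unfold Q.
    rewrite (join3_2 _ _ _ n), !join3_1, join3_0, !chi_eqb, !andb_true_iff, Nat.leb_le.
    destruct (C n), (B n); cbn; intuition discriminate. }
  split.
  - intros [[HS HI] HC].
    exists (fun n => proj1_sig (constructive_indefinite_description _ (HI n))).
    apply HE. intros n. apply HQE.
    split; [now apply HR|]. split; [apply HS|].
    exact (proj2_sig (constructive_indefinite_description _ (HI n))).
  - intros [f Hf]. rewrite HE in Hf.
    pose proof (fun n => proj1 (HQE f n) (Hf n)) as K.
    split; [split|].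
    + intros n. apply K.
    + intros m. exists (f m). apply K.
    + apply (HR C f). intros n. apply K.
Qed.

(** * The forcing argument *)

(** The witness [C] shows nonemptiness and carries the stem, its first [n] bits. Being infinite is
    asked of [C] and not of all of [R], since it is not a closed property. *)
Record condition (B : subset_of_omega) (R : subset_of_omega -> Prop)
  (C : subset_of_omega) (n : nat) : Prop := {
  condition_pi01 : pi01 B R;
  condition_witness : R C;
  condition_subset : subset C B;
  condition_infinite : infinite C;
  condition_stem : forall X, R X -> agree n C X;
  condition_closed : forall X Y, R X -> subset Y X -> agree n X Y -> R Y }.

Definition uniform_class (A B : subset_of_omega) (E : subset_of_omega -> Prop) : Prop :=
  sigma11_rel B E /\
    (exists C, E C) /\
    (forall C, E C -> subset C B /\ infinite C) /\
    (forall C, E C ->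
       exists Theta : list bool -> nat -> Prop,
         rel_ce_operator Theta /\
         (forall S, subset S C -> infinite S ->
            forall x, apply_op Theta S x <-> mem A x)).

Lemma subset_trans X Y Z : subset X Y -> subset Y Z -> subset X Z.
Proof. intros H K n Hn. auto. Qed.

(** * The operator obtained from a program and a stem *)

Lemma le_cantor_pair a b : a <= cantor_pair a b /\ b <= cantor_pair a b.
Proof.
  unfold cantor_pair. split; [|lia].
  assert (a <= (a + b) * (a + b + 1) / 2); [|lia].
  apply Nat.div_le_lower_bound; [lia|]. nia.
Qed.

(* [s] codes the stem, [c] the string whose enumerations count, and [r] an initial
   segment of the oracle. *)
Definition modifies (s r c : nat) : bool :=
  forallb (fun q => if bit s q =? 0 then implb (bit c q =? 2) (bit r q =? 2)
                    else bit c q =? bit s q) (seq 0 (c + s)).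

Lemma modifies_spec s r c : modifies s r c = true <->
  forall q, (bit s q = 0 -> bit c q = 2 -> bit r q = 2) /\
            (bit s q <> 0 -> bit c q = bit s q).
Proof.
  unfold modifies. rewrite forallb_forall. split; intros H q.
  - split; intros Hs.
    + intros Hc. specialize (H q).
      rewrite Hs, Hc in H. apply Nat.eqb_eq, H, in_seq.
      pose proof (bit_lt c q). lia.
    + specialize (H q). destruct (Nat.eqb_spec (bit s q) 0); [tauto|].
      apply Nat.eqb_eq, H, in_seq. pose proof (bit_lt s q). lia.
  - intros _. destruct (H q) as [H1 H2].
    destruct (Nat.eqb_spec (bit s q) 0).
    + destruct (Nat.eqb_spec (bit c q) 2); [|reflexivity]. apply Nat.eqb_eq. auto.
    + apply Nat.eqb_eq. auto.
Qed.

(** A subset of a member may lose part of the stem, so the stem is supplied as the constant [s]; the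
    oracle only limits which further elements the string [c] may contain. *)
Definition stem_operator (e : rfun) (s : nat) (rho : list bool) (x : nat) : Prop :=
  exists c, modifies s (code_str rho) c && runs e c x = true.

(** The search is over [c]; both components of the pair [n] are at most [n], so they are found by
    bounded search. *)
Lemma stem_operator_ce e s : rel_ce_operator (stem_operator e s).
Proof.
  set (D := fun c n => existsb (fun r => existsb (fun x =>
    (n =? cantor_pair r x) && (modifies s r c && runs e c x)) (seq 0 (S n))) (seq 0 (S n))).
  assert (HD : ce (fun n => exists c, D c n = true)).
  { apply ce_search.
    apply (cmpb_existsb 2 (fun _ r xs => existsb (fun x =>
      (nth 1 xs 0 =? cantor_pair r x) &&
      (modifies s r (nth 0 xs 0) && runs e (nth 0 xs 0) x)) (seq 0 (S (nth 1 xs 0))))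
      (fun _ xs => S (nth 1 xs 0))); [|apply cmp_succ, cmp_proj].
    apply (cmpb_existsb 3 (fun _ x ys =>
      (nth 1 (skipn 1 ys) 0 =? cantor_pair (nth 0 ys 0) x) &&
      (modifies s (nth 0 ys 0) (nth 0 (skipn 1 ys) 0) && runs e (nth 0 (skipn 1 ys) 0) x))
      (fun _ ys => S (nth 1 (skipn 1 ys) 0))).
    - apply (cmpb_ext 4 (fun _ zs =>
        (nth 3 zs 0 =? cantor_pair (nth 1 zs 0) (nth 0 zs 0)) &&
        (modifies s (nth 1 zs 0) (nth 2 zs 0) && runs e (nth 2 zs 0) (nth 0 zs 0)))).
      { intros o [|x [|r [|c [|n zs]]]] Hz; try discriminate. reflexivity. }
      apply cmpb_andb; [|apply cmpb_andb; [|apply cmpb_runs; apply cmp_proj]].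
      + apply cmpb_eqb; [apply cmp_proj|].
        apply (cmp_ext _ (fun _ zs =>
          Nat.div2 ((nth 1 zs 0 + nth 0 zs 0) * (nth 1 zs 0 + nth 0 zs 0 + 1)) + nth 0 zs 0)).
        { intros o zs _. unfold cantor_pair. now rewrite Nat.div2_div. }
        repeat first [apply cmp_proj | apply cmp_const | apply cmp_div2 |
                      apply cmp_mul | apply cmp_add].
      + apply (cmpb_forallb 4 (fun _ q zs =>
          if bit s q =? 0 then implb (bit (nth 2 zs 0) q =? 2) (bit (nth 1 zs 0) q =? 2)
          else bit (nth 2 zs 0) q =? bit s q) (fun _ zs => nth 2 zs 0 + s));
          [|apply cmp_add; [apply cmp_proj|apply cmp_const]].
        apply (cmpb_ext 5 (fun _ zs =>
          implb (bit s (nth 0 zs 0) =? 0)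
            (implb (bit (nth 3 zs 0) (nth 0 zs 0) =? 2) (bit (nth 2 zs 0) (nth 0 zs 0) =? 2)) &&
          implb (negb (bit s (nth 0 zs 0) =? 0))
            (bit (nth 3 zs 0) (nth 0 zs 0) =? bit s (nth 0 zs 0)))).
        { intros o [|q [|x [|r [|c zs]]]] Hz; try discriminate. cbn [nth skipn].
          destruct (bit s q =? 0); cbn [implb negb]; [apply andb_true_r|reflexivity]. }
        apply cmpb_andb; apply cmpb_implb; [| apply cmpb_implb | apply cmpb_negb |];
          repeat first [apply cmp_proj | apply cmp_const | apply cmp_bit | apply cmpb_eqb].
    - apply (cmp_ext _ (fun _ ys => S (nth 2 ys 0))); [|apply cmp_succ, cmp_proj].
      intros o [|r ys] H; [discriminate|reflexivity]. }
  destruct HD as [p Hp]. exists p. intros n. rewrite <- Hp. unfold D, stem_operator. split.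
  - intros (rho & x & -> & c & Hc). exists c.
    destruct (le_cantor_pair (code_str rho) x).
    apply existsb_exists. exists (code_str rho). split; [apply in_seq; lia|].
    apply existsb_exists. exists x. split; [apply in_seq; lia|].
    now rewrite Nat.eqb_refl.
  - intros (c & H). apply existsb_exists in H as (r & _ & H).
    apply existsb_exists in H as (x & _ & H). apply andb_true_iff in H as [H1 H2].
    destruct (code_surj r) as [rho <-]. exists rho, x.
    split; [now apply Nat.eqb_eq|]. now exists c.
Qed.

Lemma infinite_modify X Y k :
  infinite X -> (forall q, k <= q -> X q = true -> Y q = true) -> infinite Y.
Proof.
  intros HX H m. destruct (HX (max m k)) as (q & Hq & Hx).
  exists q. split; [lia|]. apply H; [lia|exact Hx].
Qed.

(** Each direction of correctness builds from the given set [X] a set [Y] with the stem, included in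
    [D]. Closure puts [Y] in [R], where a hypothesis on [e] applies. *)
Lemma undecided_uniform A B R C n e :
  condition B R C n ->
  (forall X x, R X -> subset X B -> infinite X -> halts (chi X) e x -> A x = true) ->
  (forall X x, R X -> subset X B -> infinite X -> A x = true ->
     exists c, fits n X c /\ runs e c x = true) ->
  uniform_class A B (fun X => (subset X B /\ infinite X) /\ R X).
Proof.
  intros [Hpi HC HCB HCi Hstem Hcl] Hin Hex.
  split; [now apply sigma11_infinite_subsets|].
  split; [now exists C|]. split; [tauto|].
  intros D [[HDB HDi] HD].
  exists (stem_operator e (code_str (init_seg C n))). split; [apply stem_operator_ce|].
  intros X HXD HXi x. split.
  - intros (rho & Hrho & c & Hc). apply andb_true_iff in Hc as [Hm Hr].
    rewrite modifies_spec in Hm.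
    (* [Y] follows the string coded by [c] and then [X], so the computation along [c] is one
       relative to [Y]. *)
    set (Y := fun q => if bit c q =? 0 then X q else bit c q =? 2).
    assert (HmC : forall q, q < n -> bit c q = 1 + chi C q).
    { intros q Hq. destruct (Hm q) as [_ H]. rewrite bit_init_seg in H.
      replace (q <? n) with true in H by (symmetry; now apply Nat.ltb_lt). now apply H. }
    assert (HYD : subset Y D).
    { intros q Hq. unfold Y in Hq. destruct (Nat.eqb_spec (bit c q) 0) as [_|H0]; [auto|].
      apply Nat.eqb_eq in Hq. destruct (le_lt_dec n q) as [L|L].
      - destruct (Hm q) as [H _]. rewrite bit_init_seg in H.
        replace (q <? n) with false in H by (symmetry; now apply Nat.ltb_ge).
        specialize (H eq_refl Hq). rewrite Hrho, bit_init_seg in H.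
        destruct (q <? length rho); [|discriminate]. unfold chi in H.
        destruct (X q) eqn:E; [auto|discriminate].
      - rewrite (HmC q L) in Hq. rewrite <- (Hstem D HD q L).
        unfold chi in Hq. destruct (C q); [reflexivity|discriminate]. }
    assert (HYi : infinite Y).
    { apply (infinite_modify X Y c HXi). intros q Hq Hx. unfold Y.
      destruct (Nat.eqb_spec (bit c q) 0) as [_|H0]; [exact Hx|].
      apply bit_lt in H0. lia. }
    apply (Hin Y x).
    + apply (Hcl D Y HD HYD). intros q Hq. rewrite <- (Hstem D HD q Hq).
      unfold Y. rewrite (HmC q Hq). unfold chi. now destruct (C q).
    + exact (subset_trans _ _ _ HYD HDB).
    + exact HYi.
    + apply (runs_sound e c); [|exact Hr].
      intros q Hq. unfold chi, Y. destruct (bit_cases c q) as [E|[E|E]];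
        rewrite E; try reflexivity. congruence.
  - intros Hx.
    (* The stem is put back in front of [X]. *)
    set (Y := fun q => if q <? n then C q else X q).
    assert (HYD : subset Y D).
    { intros q Hq. unfold Y in Hq. destruct (Nat.ltb_spec q n) as [L|L]; [|auto].
      now rewrite <- (Hstem D HD q L). }
    assert (HYi : infinite Y).
    { apply (infinite_modify X Y n HXi). intros q Hq Hxq. unfold Y.
      destruct (Nat.ltb_spec q n); [lia|exact Hxq]. }
    destruct (Hex Y x) as (c & Hf & Hr); auto.
    + apply (Hcl D Y HD HYD). intros q Hq. rewrite <- (Hstem D HD q Hq). unfold Y.
      destruct (Nat.ltb_spec q n); [reflexivity|lia].
    + exact (subset_trans _ _ _ HYD HDB).
    (* Length [c] is enough: by [bit_lt] every position of the string coded by [c] lies below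
       [c]. *)
    + exists (init_seg X c).
      split; [unfold init_seg; now rewrite length_map, length_seq|].
      exists c. rewrite Hr, andb_true_r, modifies_spec. intros q.
      rewrite !bit_init_seg. destruct (Hf q) as [H1 H2]. unfold chi, Y in *.
      destruct (Nat.ltb_spec q n) as [L|L].
      * split; [discriminate|]. intros _. exact (H2 L).
      * split; [|tauto]. intros _ Hc.
        assert (q < c) by (apply bit_lt; lia).
        destruct (Nat.ltb_spec q c); [|lia]. now rewrite (H1 Hc).
Qed.

(** * Extending a condition to defeat one program *)

(** The set built at the end is a limit of witnesses. Requirements can be stated for limits because
    each violation would show in finitely many bits. *)
Definition in_closure (R : subset_of_omega -> Prop) (X : subset_of_omega) : Prop :=
  forall k, exists Y, R Y /\ agree k Y X.

(** A subset keeping the longer stem keeps the shorter one, so both closure properties survive. *)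
Lemma condition_lengthen B R C n R' X n' :
  condition B R C n -> pi01 B R' -> n <= n' ->
  (forall Y Z, R' Y -> subset Z Y -> agree n Y Z -> R' Z) ->
  R X -> R' X -> subset X B -> infinite X ->
  condition B (fun Y => (R Y /\ R' Y) /\ agree n' X Y) X n'.
Proof.
  intros [Hpi HC HCB HCi Hstem Hcl] Hpi' Hn Hcl' HX HX' HXB HXi. constructor; auto.
  - apply pi01_and; [now apply pi01_and|apply pi01_agree].
  - repeat split; auto.
  - tauto.
  - intros Y Z [[HY HY'] Ha] HZY HYZ.
    pose proof (agree_le _ _ _ _ Hn HYZ). repeat split; eauto using agree_trans.
Qed.

Lemma condition_step A B R C n e :
  ~ (exists E, uniform_class A B E) -> condition B R C n ->
  exists R' C' n', condition B R' C' n' /\ (forall X, R' X -> R X) /\ n < n' /\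
    (exists q, n <= q < n' /\ C' q = true) /\
    (forall X, in_closure R' X -> ~ (forall x, mem A x <-> halts (chi X) e x)).
Proof.
  intros Hno Hc.
  (* Each new stem takes in one more element, which makes the limit infinite. *)
  assert (Hlen : forall X u, infinite X -> exists n', n < n' /\ u <= n' /\
            exists q, n <= q < n' /\ X q = true).
  { intros X u HX. destruct (HX n) as (q & Hq & Hx). exists (S (q + u)).
    repeat split; try lia. exists q. split; [lia|exact Hx]. }
  destruct (classic (exists X x, R X /\ subset X B /\ infinite X /\
                       halts (chi X) e x /\ A x <> true))
    as [(X & x & HX & HXB & HXi & Hh & HA)|N1].
  { destruct (runs_complete _ _ _ Hh) as [u Hu].
    destruct (Hlen X u HXi) as (n' & Hn & Hun & Hq).
    (* Here the stem alone forces the wrong enumeration, so the added class is trivial. *)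
    exists (fun Y => (R Y /\ True) /\ agree n' X Y), X, n'.
    split; [apply (condition_lengthen B R C n); auto using pi01_true; lia|].
    split; [tauto|]. split; [exact Hn|]. split; [exact Hq|].
    intros Z HZ H. apply HA, H.
    destruct (HZ n') as (Y & [_ HXY] & HYZ).
    apply (runs_sound e (code_str (init_seg X n'))); [|auto].
    intros q Hq0. rewrite bit_init_seg in *. destruct (Nat.ltb_spec q n') as [L|]; [|tauto].
    unfold chi. now rewrite (HXY q L), (HYZ q L). }
  destruct (classic (exists X x, R X /\ subset X B /\ infinite X /\ A x = true /\
                       forall c, fits n X c -> runs e c x = false))
    as [(X & x & HX & HXB & HXi & HA & Hf)|N2].
  { destruct (Hlen X 0 HXi) as (n' & Hn & _ & Hq).
    exists (fun Y => (R Y /\ forall c, fits n Y c -> runs e c x = false) /\ agree n' X Y), X, n'.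
    split.
    { apply (condition_lengthen B R C n _ X n' Hc); auto using pi01_never_runs; [lia|].
      (* A string that fits a subset with the same stem fits the larger set too. *)
      intros Y Z HY HZY HYZ c Hfc. apply HY. intros q. destruct (Hfc q) as [H1 H2].
      split; [auto|]. intros L. rewrite (H2 L). unfold chi. now rewrite (HYZ q L). }
    split; [tauto|]. split; [exact Hn|]. split; [exact Hq|].
    intros Z HZ H. apply H in HA. destruct (runs_complete _ _ _ HA) as [u Hu].
    (* A member [Y] close to [Z] shares the initial segment along which [e] enumerates [x]; the
       maximum with [n] makes that segment contain the stem. *)
    destruct (HZ (max u n)) as (Y & [[_ HY] _] & HYZ).
    specialize (Hu (max u n) ltac:(lia)). rewrite HY in Hu; [discriminate|].
    intros q. rewrite bit_init_seg.
    destruct (Nat.ltb_spec q (max u n)) as [L|L]; [|split; [discriminate|lia]].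
    unfold chi. rewrite (HYZ q L). destruct (Z q); split; auto; discriminate. }
  destruct Hno. eexists. apply (undecided_uniform A B R C n e Hc).
  - intros X x HX HXB HXi Hh. apply NNPP. intros HA. apply N1. exists X, x. auto.
  - intros X x HX HXB HXi HA. apply NNPP. intros Hn. apply N2. exists X, x.
    repeat split; auto. intros c Hfc. destruct (runs e c x) eqn:E; [|reflexivity].
    destruct Hn. eauto.
Qed.

(** * The sequence of conditions and its limit *)

Lemma dependent_choice {T : Type} (P : T -> Prop) (Q : nat -> T -> T -> Prop) t0 :
  P t0 -> (forall k t, P t -> exists t', P t' /\ Q k t t') ->
  exists s : nat -> T, forall k, P (s k) /\ Q k (s k) (s (S k)).
Proof.
  intros H0 H.
  assert (F : forall k (t : {t | P t}), {t' : {t | P t} | Q k (proj1_sig t) (proj1_sig t')}).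
  { intros k [t Ht]. apply constructive_indefinite_description.
    destruct (H k t Ht) as (t' & Ht' & HQ). now exists (exist _ t' Ht'). }
  set (s := nat_rect (fun _ => {t | P t}) (exist _ t0 H0) (fun k t => proj1_sig (F k t))).
  exists (fun k => proj1_sig (s k)). intros k. split; [apply proj2_sig|].
  exact (proj2_sig (F k (s k))).
Qed.

Theorem theorem3p11 (A B : subset_of_omega) :
  infinite B ->
  (forall S, subset S B -> infinite S -> ce_rel (chi S) (mem A)) ->
  exists E : subset_of_omega -> Prop,
    sigma11_rel B E /\
    (exists C, E C) /\
    (forall C, E C -> subset C B /\ infinite C) /\
    (forall C, E C ->
       exists Theta : list bool -> nat -> Prop,
         rel_ce_operator Theta /\
         (forall S, subset S C -> infinite S ->
            forall x, apply_op Theta S x <-> mem A x)).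
Proof.
  intros HB HA. apply NNPP. intros Hno.
  change (~ exists E, uniform_class A B E) in Hno.
  destruct (dependent_choice
    (fun t : (subset_of_omega -> Prop) * subset_of_omega * nat =>
       condition B (fst (fst t)) (snd (fst t)) (snd t))
    (fun k t t' => (forall X, fst (fst t') X -> fst (fst t) X) /\ snd t < snd t' /\
       (exists q, snd t <= q < snd t' /\ snd (fst t') q = true) /\
       (forall e, rfun_code e = k -> forall X, in_closure (fst (fst t')) X ->
          ~ (forall x, mem A x <-> halts (chi X) e x)))
    (* The weakest condition: all sets, witness [B], empty stem. *)
    (fun _ => True, B, 0)) as [s Hs].
  { constructor; cbn; auto.
    - apply pi01_true.
    - intros n Hn. exact Hn.
    - intros X _ q Hq. lia. }
  { intros k [[R C] n] Hc. cbn [fst snd] in *.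
    destruct (classic (exists e, rfun_code e = k)) as [[e He]|N].
    - destruct (condition_step A B R C n e Hno Hc) as (R' & C' & n' & H1 & H2 & H3 & H4 & H5).
      exists (R', C', n'). cbn [fst snd]. do 4 (split; [assumption|]).
      intros e' He'. replace e' with e; [exact H5|]. apply rfun_code_inj. congruence.
    (* No program has code [k]; an arbitrary one is treated so that the stem still grows. *)
    - destruct (condition_step A B R C n RZero Hno Hc) as (R' & C' & n' & H1 & H2 & H3 & H4 & H5).
      exists (R', C', n'). cbn [fst snd]. do 4 (split; [assumption|]).
      intros e' He'. destruct N. eauto. }
  set (R k := fst (fst (s k))). set (C k := snd (fst (s k))). set (n k := snd (s k)).
  assert (Hc : forall k, condition B (R k) (C k) (n k)) by (intros k; apply Hs).
  assert (Hn : forall k, k <= n k).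
  { induction k as [|k IH]; [lia|]. destruct (Hs k) as (_ & _ & H & _).
    fold (n k) (n (S k)) in H. lia. }
  assert (HR : forall k j X, R (j + k) X -> R k X).
  { induction j as [|j IH]; auto. intros X HX. apply IH.
    exact (proj1 (proj2 (Hs (j + k))) X HX). }
  assert (Ha : forall k j, k <= j -> agree (n k) (C k) (C j)).
  { intros k j Hkj. apply (condition_stem _ _ _ _ (Hc k)).
    apply (HR k (j - k)). replace (j - k + k) with j by lia.
    apply (condition_witness _ _ _ _ (Hc j)). }
  (* Bit [q] is settled by stage [S q], whose stem has length at least [S q]. *)
  set (X q := C (S q) q).
  assert (HX : forall k, agree (n k) (C k) X).
  { intros k q Hq. unfold X. destruct (le_lt_dec k (S q)).
    - now apply Ha.
    - symmetry. apply Ha; [lia|]. specialize (Hn (S q)). lia. }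
  assert (HXB : subset X B) by (intros q; apply (condition_subset _ _ _ _ (Hc (S q)))).
  assert (HXi : infinite X).
  { intros m. destruct (Hs m) as (_ & _ & _ & (q & Hq & Hqc) & _).
    fold (n m) (n (S m)) (C (S m)) in Hq, Hqc. specialize (Hn m).
    exists q. split; [lia|]. rewrite <- (HX (S m) q); [exact Hqc|lia]. }
  destruct (HA X HXB HXi) as [e He].
  destruct (Hs (rfun_code e)) as (_ & _ & _ & _ & H).
  apply (H e eq_refl X); [|exact He].
  (* This stage is late enough both to lie in the class that defeats [e] and to agree with [X] below
     [k]. *)
  intros k. exists (C (k + S (rfun_code e))). split.
  - apply (HR _ k). apply (condition_witness _ _ _ _ (Hc _)).
  - apply (agree_le k (n (k + S (rfun_code e)))); [|apply HX].
    specialize (Hn (k + S (rfun_code e))). lia.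
Qed.
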